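(* Let $2\le n<\infty$, and let $P=(p_{ij})_{1\le i,j\le n}$ be an irreducible, aperiodic transition matrix reversible with respect to a probability vector $\pi=(\pi_i)_{1\le i\le n}$. Let $\mathbf{Y}(t)=(Y_i(t))_{1\le i\le n}$, $t\ge 0$, be the smoothing process associated with $P$, started from any (possibly random) initial configuration $\mathbf{Y}(0)\ge 0$, let $\mathcal{V}(t)$ be its variance functional, and let $\gamma^{(2)}$ be the spectral gap of the two-step chain with transition matrix $P^2$. Then for any $t\ge s\ge 0$, $$\mathbb{E}\,\mathcal{V}(t)\le \mathbb{E}\,\mathcal{V}(s)\,\exp\left(-\gamma^{(2)}(t-s)\right).$$ Consequently, for any $t\ge 0$, $\mathbb{E}\,\mathcal{V}(t)\le \mathbb{E}\,\mathcal{V}(0)\exp\left(-\gamma^{(2)}t\right)$.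
   Context: Reversibility means $\pi_i p_{ij}=\pi_j p_{ji}$ for all $i,j$. Smoothing process: sites are $\{1,\dots,n\}$; each site carries a unit-intensity Poisson process (clock); all clocks are jointly independent and independent of $\mathbf{Y}(0)$. When the clock at site $k$ rings at time $t$, the value at $k$ is updated to $Y_k(t)=\sum_{j=1}^n p_{kj}Y_j(t-)$, and the values at the other sites remain unchanged. For $\mathbf{y}=(y_1,\dots,y_n)$ let $\overline{y}=\sum_{i=1}^n\pi_i y_i$ and $\mathbf{V}(\mathbf{y})=\sum_{i=1}^n\pi_i(y_i-\overline{y})^2$. The variance functional is $\mathcal{V}(t)=\mathbf{V}(\mathbf{Y}(t))$. Let $1=\lambda_0>\lambda_1\ge\dots\ge\lambda_{n-1}>-1$ be the eigenvalues of $P$ and $\lambda_*=\max\{|\lambda_i|:\lambda_i<1\}$. The spectral gap of the two-step chain is $\gamma^{(2)}=1-\lambda_*^2$. *)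

(* Defs.v *)
From HB Require Import structures.
From mathcomp Require Export all_boot all_order all_algebra.
From mathcomp Require Export all_classical all_reals all_analysis.

Set Implicit Arguments.
Unset Strict Implicit.
Unset Printing Implicit Defensive.

Export Order.TTheory GRing.Theory Num.Theory.
Export numFieldNormedType.Exports.

Local Open Scope classical_set_scope.
Local Open Scope ring_scope.

Section markov_chain.
Context {R : realType} {n : nat}.
Implicit Types (P : 'M[R]_n) (pi : 'I_n -> R) (y : 'I_n -> R).

Definition transition_matrix P :=
  (forall i j, 0 <= P i j) /\ (forall i, \sum_(j < n) P i j = 1).

Definition irreducible P := forall i j, exists m : nat, 0 < (P ^+ m) i j.

(* For every i, the gcd of the possible return times to i is 1. *)
Definition aperiodic P := forall (i : 'I_n) (d : nat),
  (forall m : nat, (0 < m)%N -> 0 < (P ^+ m) i i -> (d %| m)%N) -> d = 1%N.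

Definition probability_vector pi :=
  (forall i, 0 <= pi i) /\ \sum_(i < n) pi i = 1.

Definition reversible P pi := forall i j, pi i * P i j = pi j * P j i.

(* [eigenvalue] refers to row eigenvectors and to the base field R: a square
   matrix has the same spectrum acting on rows and on columns, and the spectrum
   of a reversible irreducible P is real.  The set below is finite, and it is
   nonempty when n >= 2 and P is irreducible and reversible, so that the
   supremum is a maximum. *)
Definition lambda_star P : R :=
  sup [set `|a| | a in [set a : R | eigenvalue P a /\ a < 1]].

Definition two_step_gap P : R := 1 - lambda_star P ^+ 2.

Definition wmean pi y : R := \sum_(i < n) pi i * y i.

Definition wvar pi y : R := \sum_(i < n) pi i * (y i - wmean pi y) ^+ 2.

End markov_chain.

Section independence.
Context {d : measure_display} {T : measurableType d} {R : realType}.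
Variable Pr : probability T R.

Definition mutually_independent (I : finType) (G : I -> set_system T) :=
  forall A : I -> set T, (forall i, G i (A i)) ->
  forall J : {set I},
    Pr (\bigcap_(i in [set` J]) A i) = (\prod_(i in J) Pr (A i))%E.

(* The sigma-algebra on T generated by the random elements X i, for i in D. *)
Definition sigma_gen {d' : measure_display} {U : measurableType d'}
    {I : Type} (D : set I) (X : I -> T -> U) : set_system T :=
  <<s \bigcup_(i in D) preimage_set_system setT (X i) measurable >>.

End independence.

Section smoothing.
Context {d : measure_display} {T : measurableType d} {R : realType}.
Variable Pr : probability T R.

(* Unit-intensity Poisson process: [N t w] is the number of rings in ]0, t];
   only the times t >= 0 are relevant.  The truncated subtraction of nat is
   harmless because almost all paths are nondecreasing. *)
Record poisson_clock (N : R -> {RV Pr >-> nat}) : Prop := PoissonClock {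
  clock_start : {ae Pr, forall w, N 0 w = 0%N} ;
  clock_homo : {ae Pr, forall w, forall s t : R,
    0 <= s -> s <= t -> (N s w <= N t w)%N} ;
  clock_right_cont : {ae Pr, forall w, forall t : R,
    0 <= t -> N u w @[u --> t^'+] --> N t w} ;
  clock_indep_incr : forall (m : nat) (t : nat -> R),
    0 <= t 0%N -> (forall i, (i < m)%N -> t i <= t i.+1) ->
    mutually_independent Pr (fun i : 'I_m =>
      sigma_gen [set: unit] (fun _ w => (N (t i.+1) w - N (t i) w)%N)) ;
  clock_poisson : forall (s t : R) (j : nat), 0 <= s -> s < t ->
    Pr [set w | (N t w - N s w)%N = j] = (poisson_pmf (t - s) j)%:E }.

Definition rings (N : R -> T -> nat) (w : T) (t : R) : Prop :=
  0 < t /\ forall s, 0 <= s -> s < t -> (N s w < N t w)%N.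

(* [Y t k] is the value at site k and time t; only the times t >= 0 are
   relevant.  Almost surely no two clocks ring simultaneously. *)
Record smoothing_process (n : nat) (P : 'M[R]_n)
    (N : 'I_n -> R -> {RV Pr >-> nat}) (Y : R -> 'I_n -> {RV Pr >-> R})
    : Prop := SmoothingProcess {
  smoothing_clock : forall k, poisson_clock (N k) ;
  smoothing_indep : mutually_independent Pr (fun o : option 'I_n =>
    if o is Some k then sigma_gen [set t : R | 0 <= t] (N k)
    else sigma_gen [set: 'I_n] (Y 0)) ;
  smoothing_update : {ae Pr, forall w, forall (k : 'I_n) (t : R),
    rings (N k) w t ->
    Y t k w = \sum_(j < n) P k j * lim (Y s j w @[s --> t^'-])} ;
  smoothing_const : {ae Pr, forall w, forall (k : 'I_n) (s t : R),
    0 <= s -> s <= t -> (forall u, s < u -> u <= t -> ~ rings (N k) w u) ->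
    Y t k w = Y s k w} }.

Definition variance_functional (n : nat) (pi : 'I_n -> R)
    (Y : R -> 'I_n -> {RV Pr >-> R}) (t : R) : T -> R :=
  fun w => wvar pi (fun i => Y t i w).

End smoothing.

(* Main.v *)
From HB Require Import structures.
From mathcomp Require Import ring lra zify measurable_realfun.
Require Import Defs.

(** Why the theorem is true.

    Let [|y|] be the norm with weights [pi].  If the clock at a uniformly chosen
    site rings, the second moment of a mean-zero configuration changes on average
    by [(|P y|^2 - |y|^2) / n], and reversibility makes [P] self-adjoint, so that
    [|P y|^2 <= lambda_star^2 |y|^2].  Hence [\sum_k V(y^k) <= (n - gap) V(y)],
    where [y^k] is [y] after an update at [k] ([sum_wvar_upd]).  As rings come at
    rate 1 at every site, the expected variance decays at rate at least [gap].

    The spectral inequality ([avg_contraction]) is proved variationally: the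
    maximum of [|P y|^2] over the mean-zero unit sphere is attained, a maximizer is
    an eigenfunction of [P^2], and it yields an eigenfunction of [P] whose
    eigenvalue is, up to sign, the square root of the maximum.  Irreducibility
    excludes the eigenvalue 1 by a maximum principle.

    Continuous time is handled by discretization: time is cut by a grid that
    contains both [s] and [t].  A path prescribes for every step of the grid
    that no clock rings, or that exactly one named clock rings, exactly once.  On
    the event that the rings follow a path [a] ([cell]), the configuration at the
    end of the grid is a fixed linear image [run P a] of the initial one
    ([smoothing_run]); by independence the event has an explicit probability
    [weight h a] and is independent of the initial configuration ([cell_indep]).
    So, with [F m y = \sum_a weight h a * V(run P a y)] over the paths of length
    [m], the number [E F m (Y 0)] is the expected variance after [m] steps,
    restricted to the event that no step has had two rings.  The one-update
    inequality gives [F (m + 1) y <= exp(- gap h_m) F m y] for every [y], whence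

    - [E (V(t); no double ring up to t)
         <= exp(- gap (t - s)) E (V(s); no double ring up to s)
         <= exp(- gap (t - s)) E V(s)].

    A double ring in some step has probability at most the sum of the [(n h_i)^2],
    which tends to 0 as the grid is refined; truncating [V(t)] at a level [K]
    makes its contribution negligible ([truncated_variance_le]), and [K] tends to
    infinity by monotone convergence.  All integrands are nonnegative, and the
    integrals may be infinite. *)

Set Implicit Arguments.
Unset Strict Implicit.
Unset Printing Implicit Defensive.

Local Open Scope classical_set_scope.
Local Open Scope ring_scope.

(** * The averaging operator of a reversible chain *)

Section chain.
Context {R : realType} {n : nat}.
Implicit Types (P : 'M[R]_n) (pi x y z : 'I_n -> R).

Definition avg P y : 'I_n -> R := fun i => \sum_(j < n) P i j * y j.

Definition dotpi pi x y : R := \sum_(i < n) pi i * x i * y i.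

Lemma dotpiC pi x y : dotpi pi x y = dotpi pi y x.
Proof. by apply: eq_bigr => i _; rewrite -!mulrA (mulrC (x i)). Qed.

Lemma dotpiDr pi x y z :
  dotpi pi x (fun i => y i + z i) = dotpi pi x y + dotpi pi x z.
Proof. by rewrite -big_split; apply: eq_bigr => i _; rewrite mulrDr. Qed.

Lemma dotpiZr pi a x y : dotpi pi x (fun i => a * y i) = a * dotpi pi x y.
Proof. by rewrite /dotpi mulr_sumr; apply: eq_bigr => i _; rewrite mulrCA. Qed.

Lemma avgD P y z :
  avg P (fun i => y i + z i) = (fun i => avg P y i + avg P z i).
Proof.
by apply/funext => i; rewrite -big_split; apply: eq_bigr => j _; rewrite mulrDr.
Qed.

Lemma avgZ P a y : avg P (fun i => a * y i) = (fun i => a * avg P y i).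
Proof.
by apply/funext => i; rewrite /avg mulr_sumr; apply: eq_bigr => j _; rewrite mulrCA.
Qed.

Lemma avg_cst P c : transition_matrix P -> avg P (fun=> c) = (fun=> c).
Proof.
by move=> [_ P1]; apply/funext => i; rewrite /avg -mulr_suml P1 mul1r.
Qed.

(** Reversibility is self-adjointness of [P] for the weights [pi]. *)
Lemma dotpi_avg P pi x y : reversible P pi ->
  dotpi pi (avg P x) y = dotpi pi x (avg P y).
Proof.
move=> rev.
transitivity (\sum_(i < n) \sum_(j < n) pi i * P i j * x j * y i).
  apply: eq_bigr => i _; rewrite /avg mulr_sumr mulr_suml.
  by apply: eq_bigr => j _; rewrite !mulrA.
rewrite exchange_big; apply: eq_bigr => i _ /=.
by rewrite /avg mulr_sumr; apply: eq_bigr => j _; rewrite rev; ring.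
Qed.

Lemma wmeanE pi y : wmean pi y = dotpi pi (fun=> 1) y.
Proof. by apply: eq_bigr => i _; rewrite mulr1. Qed.

Lemma wmean_avg P pi y : transition_matrix P -> reversible P pi ->
  wmean pi (avg P y) = wmean pi y.
Proof. by move=> tP rev; rewrite !wmeanE -dotpi_avg// avg_cst. Qed.

Lemma dotpi_ge0 pi y : (forall i, 0 <= pi i) -> 0 <= dotpi pi y y.
Proof.
by move=> p0; apply: sumr_ge0 => i _; rewrite -mulrA mulr_ge0// -expr2 sqr_ge0.
Qed.

Lemma dotpi_eq0 pi y : (forall i, 0 < pi i) -> dotpi pi y y = 0 -> y = (fun=> 0).
Proof.
move=> p0 /eqP; rewrite psumr_eq0; last first.
  by move=> i _; rewrite -mulrA -expr2 mulr_ge0 ?sqr_ge0// ltW.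
move=> /allP h; apply/funext => i.
have := h i (mem_index_enum _); rewrite -mulrA mulf_eq0 gt_eqF//= mulf_eq0 orbb.
by move/eqP.
Qed.

Lemma powmx_transition P m : transition_matrix P -> transition_matrix (P ^+ m).
Proof.
move=> [P0 P1]; elim: m => [|m [IH0 IH1]]; split=> i.
- by move=> j; rewrite expr0 mxE ler0n.
- rewrite (bigD1 i)//= big1 ?addr0 ?expr0 ?mxE ?eqxx// => j ji.
  by rewrite mxE eq_sym (negbTE ji).
- by move=> j; rewrite exprS mxE; apply: sumr_ge0 => k _; rewrite mulr_ge0.
- rewrite exprS; under eq_bigr do rewrite mxE.
  rewrite exchange_big /= -[RHS](P1 i); apply: eq_bigr => k _.
  by rewrite -mulr_sumr IH1 mulr1.
Qed.

Lemma powmx_reversible P pi m : reversible P pi -> reversible (P ^+ m) pi.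
Proof.
move=> rev; elim: m => [|m IH] i j.
  by rewrite expr0 !mxE eq_sym; case: eqP => [->//|_]; rewrite !mulr0.
rewrite [in LHS]exprS exprSr !mxE !mulr_sumr; apply: eq_bigr => k _.
by rewrite mulrA rev -mulrA mulrCA IH mulrCA [X in _ * X]mulrC.
Qed.

Lemma stationary_gt0 P pi : irreducible P -> probability_vector pi ->
  reversible P pi -> forall i, 0 < pi i.
Proof.
move=> irr [p0 p1] rev j.
have [i pi0] : exists i, 0 < pi i.
  apply/not_existsP => h.
  have : \sum_(i < n) pi i = 0.
    by apply: big1 => i _; apply/eqP; rewrite eq_le p0 andbT leNgt; apply/negP/h.
  by rewrite p1 => /eqP; rewrite oner_eq0.
have [m Pij] := irr i j.
have := powmx_reversible m rev i j => e.
have : 0 < pi j * (P ^+ m) j i by rewrite -e mulr_gt0.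
by move=> h; rewrite lt_neqAle p0 andbT; apply/eqP => pj0; move: h; rewrite -pj0 mul0r ltxx.
Qed.

Lemma avg_pow_eigen P a y m : avg P y = (fun i => a * y i) ->
  avg (P ^+ m) y = (fun i => a ^+ m * y i).
Proof.
move=> e; elim: m => [|m IH]; apply/funext => i.
  rewrite /avg (bigD1 i)//= big1 ?addr0 ?expr0 ?mxE ?eqxx// => j ji.
  by rewrite mxE eq_sym (negbTE ji) mul0r.
transitivity (avg P (avg (P ^+ m) y) i); last first.
  by rewrite IH avgZ e mulrA -exprSr.
rewrite /avg exprS; under eq_bigr do rewrite mxE mulr_suml.
rewrite exchange_big; apply: eq_bigr => k _.
by rewrite /= mulr_sumr; apply: eq_bigr => j _; rewrite mulrA.
Qed.

(** Maximum principle: an eigenfunction with eigenvalue at least 1 is constant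
    by irreducibility, so it cannot have mean zero unless it vanishes.  The
    powers of [P] carry the comparison from a maximizer to every other site. *)
Lemma meanzero_eigen_lt1 P pi a y : transition_matrix P -> irreducible P ->
  (forall i, 0 < pi i) -> wmean pi y = 0 -> y <> (fun=> 0) ->
  avg P y = (fun i => a * y i) -> a < 1.
Proof.
move=> tP irr p0 y0 yn0 e; rewrite ltNge; apply/negP => a1.
have [i0 _] : exists i : 'I_n, True.
  by apply/not_existsP => h; apply: yn0; apply/funext => i; case: (h i).
have [i _ imax] : exists2 i, xpredT i & forall j, y j <= y i.
  case: (@Order.TotalTheory.arg_maxP _ _ _ i0 xpredT y erefl) => i _ h.
  by exists i => // j; exact: h.
have yi : 0 < y i.
  rewrite ltNge; apply/negP => yi0; apply: yn0; apply/funext => j.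
  have : \sum_(k < n) pi k * - y k = 0.
    by under eq_bigr do rewrite mulrN; rewrite sumrN; apply/eqP; rewrite oppr_eq0; apply/eqP.
  move/eqP; rewrite psumr_eq0 => [/allP/(_ j (mem_index_enum _))|k _].
    by rewrite mulf_eq0 gt_eqF//= oppr_eq0 => /eqP.
  by rewrite mulr_ge0 ?oppr_ge0 ?(le_trans (imax k))// ltW.
have yc j : y j = y i.
  have [m Pij] := irr i j.
  have [Pm0 Pm1] := powmx_transition m tP.
  have h : \sum_(k < n) (P ^+ m) i k * (y i - y k) <= 0.
    under eq_bigr do rewrite mulrBr.
    rewrite sumrB -mulr_suml Pm1 mul1r subr_le0.
    rewrite [leRHS](_ : _ = avg (P ^+ m) y i)// (avg_pow_eigen m e).
    by rewrite ler_peMl ?exprn_ege1// ltW.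
  have g k : 0 <= (P ^+ m) i k * (y i - y k) by rewrite mulr_ge0// subr_ge0.
  have : \sum_(k < n) (P ^+ m) i k * (y i - y k) == 0.
    by rewrite eq_le h sumr_ge0.
  rewrite psumr_eq0// => /allP/(_ j (mem_index_enum _)).
  by rewrite mulf_eq0 gt_eqF//= subr_eq0 => /eqP.
have : 0 < wmean pi y.
  rewrite /wmean (bigD1 i)//= ltr_pwDl ?mulr_gt0//.
  by apply: sumr_ge0 => k _; rewrite yc mulr_ge0// ltW.
by rewrite y0 ltxx.
Qed.

Lemma eigenvalue_le1 P a : transition_matrix P -> eigenvalue P a -> `|a| <= 1.
Proof.
move=> [P0 P1] /eigenvalueP[v ev vn0].
have s0 : 0 < \sum_(j < n) `|v 0 j|.
  rewrite lt_neqAle sumr_ge0// andbT; apply: contra vn0.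
  rewrite eq_sym psumr_eq0// => /allP h; apply/eqP/rowP => j; rewrite mxE.
  by have := h j (mem_index_enum _); rewrite normr_eq0 => /eqP.
rewrite -(ler_pM2r s0) mul1r mulr_sumr.
apply: (@le_trans _ _ (\sum_(j < n) \sum_(i < n) `|v 0 i| * P i j)).
  apply: ler_sum => j _; rewrite -normrM.
  have -> : a * v 0 j = \sum_(i < n) v 0 i * P i j.
    by have := congr1 (fun A : 'rV[R]_n => A 0 j) ev; rewrite !mxE => <-.
  apply: le_trans (ler_norm_sum _ _ _) _; apply: ler_sum => i _.
  by rewrite normrM (ger0_norm (P0 _ _)).
rewrite exchange_big; apply: ler_sum => i _ /=.
by rewrite -mulr_sumr P1 mulr1.
Qed.

(** A nonzero mean-zero eigenfunction for [a], weighted by [pi], is a row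
    eigenvector for [a]; the value 1 is excluded by the maximum principle. *)
Lemma meanzero_eigen_le_lambda_star P pi a y : transition_matrix P ->
  irreducible P -> reversible P pi ->
  (forall i, 0 < pi i) -> wmean pi y = 0 -> y <> (fun=> 0) ->
  avg P y = (fun i => a * y i) -> `|a| <= lambda_star P.
Proof.
move=> tP irr rev p0 y0 yn0 e; apply: ub_le_sup.
  by exists 1 => _ [b [/(eigenvalue_le1 tP) ? _] <-].
exists a => //; split; last exact: (meanzero_eigen_lt1 tP irr p0 y0).
apply/eigenvalueP; exists (\row_i (pi i * y i)).
  apply/rowP => j; rewrite !mxE.
  under eq_bigr do rewrite mxE -mulrA (mulrC (y _)) mulrA rev -mulrA.
  by rewrite -mulr_sumr [X in _ * X = _](_ : _ = avg P y j)// e mulrCA.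
apply/eqP => h; apply: yn0; apply/funext => i.
have /eqP := congr1 (fun A : 'rV[R]_n => A 0 i) h.
by rewrite !mxE mulf_eq0 gt_eqF//= => /eqP.
Qed.

(** * The spectral bound on mean-zero functions *)

Lemma dotpi_continuous pi (f g : 'I_n -> 'rV[R]_n -> R) :
  (forall i, continuous (f i)) -> (forall i, continuous (g i)) ->
  continuous (fun v => dotpi pi (f^~ v) (g^~ v)).
Proof.
move=> cf cg; apply: continuous_big => [|i _ v]; first exact: add_continuous.
by apply: cvgM (cg i v); apply: cvgM (cf i v); exact: cvg_cst.
Qed.

Lemma avg_continuous P i : continuous (fun v : 'rV[R]_n => avg P (v 0) i).
Proof.
apply: continuous_big => [|j _ v]; first exact: add_continuous.
by apply: cvgM (@coord_continuous R 1 n 0 j v); exact: cvg_cst.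
Qed.

Lemma meanzero_sphere_compact pi : (forall i, 0 < pi i) ->
  compact [set v : 'rV[R]_n | dotpi pi (v 0) (v 0) = 1 /\ wmean pi (v 0) = 0].
Proof.
move=> p0.
pose box i : set R := `[- (1 + (pi i)^-1), 1 + (pi i)^-1]%classic.
have box_compact : compact [set v : 'rV[R]_n | forall i, box i (v ord0 i)].
  by apply: rV_compact => i; exact: segment_compact.
apply: subclosed_compact box_compact _.
- apply: closedI.
    apply: (@preimage_closed _ _ (fun v : 'rV[R]_n => dotpi pi (v 0) (v 0)) [set 1]) => //.
    by move=> v _; apply: dotpi_continuous => i; exact: coord_continuous.
  apply: (@preimage_closed _ _ (fun v : 'rV[R]_n => wmean pi (v 0)) [set 0]) => //.
  move=> v _; apply: continuous_big => [|i _ u]; first exact: add_continuous.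
  by apply: cvgM (@coord_continuous R 1 n 0 i u); exact: cvg_cst.
- move=> v [v1 _] i; rewrite /box /= in_itv/= -ler_norml.
  have vi : pi i * v 0 i ^+ 2 <= 1.
    rewrite -v1 /dotpi (bigD1 i)//= -mulrA -expr2 lerDl.
    by apply: sumr_ge0 => j _; rewrite -mulrA -expr2 mulr_ge0 ?sqr_ge0// ltW.
  have {}vi : `|v 0 i| ^+ 2 <= (pi i)^-1.
    by rewrite real_normK ?num_real// -[leRHS]mul1r ler_pdivlMr// mulrC.
  by have := normr_ge0 (v 0 i); move: vi; set a := `|_|; set b := _^-1; nra.
Qed.

Lemma dotpi_quad pi x z (t : R) :
  dotpi pi (fun i => x i + t * z i) (fun i => x i + t * z i) =
  dotpi pi x x + 2 * t * dotpi pi x z + t ^+ 2 * dotpi pi z z.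
Proof.
rewrite dotpiDr dotpiZr !(dotpiC pi (fun i => _ + _)) !dotpiDr !dotpiZr.
by rewrite (dotpiC pi z x); ring.
Qed.

(** For [t] of the sign opposite to [c] and small, the linear term would
    dominate; [t = - c / (b + 1)] is small enough. *)
Lemma ge0_quad_linear0 (b c : R) :
  0 <= b -> (forall t, 0 <= 2 * t * c + t ^+ 2 * b) -> c = 0.
Proof.
move=> b0 h; apply/eqP; rewrite -sqrf_eq0 eq_le sqr_ge0 andbT.
have b1 : 0 < b + 1 by rewrite ltr_wpDl.
have := h (- c / (b + 1)).
have -> : 2 * (- c / (b + 1)) * c + (- c / (b + 1)) ^+ 2 * b =
  (c ^+ 2 / (b + 1) ^+ 2) * - (b + 2) by field; rewrite gt_eqF.
rewrite mulrN oppr_ge0 pmulr_lle0 ?ltr_wpDl//.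
by rewrite pmulr_lle0// invr_gt0 exprn_gt0.
Qed.

(** The Rayleigh quotient of [P ^ 2] on mean-zero functions is maximal at some
    [x] by compactness; its first variation vanishes there, so that [x] is an
    eigenfunction of [P ^ 2], with eigenvalue [mu] say.  Then either [P x + a x]
    is an eigenfunction of [P] for [a = sqrt mu], or it is zero and [x] is one
    for [- a]; in both cases [mu <= lambda_star P ^ 2]. *)
Lemma avg_contraction P pi y : transition_matrix P -> irreducible P ->
  reversible P pi -> (forall i, 0 < pi i) -> wmean pi y = 0 ->
  dotpi pi (avg P y) (avg P y) <= lambda_star P ^+ 2 * dotpi pi y y.
Proof.
move=> tP irr rev p0 y0.
have p0' i : 0 <= pi i by exact: ltW.
have [->|yn0] := pselect (y = fun=> 0).
  by rewrite avg_cst// /dotpi !big1 ?mulr0// => i _; rewrite !mulr0.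
pose K := [set v : 'rV[R]_n | dotpi pi (v 0) (v 0) = 1 /\ wmean pi (v 0) = 0].
have normalize z : wmean pi z = 0 -> z <> (fun=> 0) ->
    exists2 v, v \in K & exists2 c, 0 < c & z = (fun i => c * v 0 i).
  move=> z0 zn0; set q := dotpi pi z z.
  have q0 : 0 < q.
    rewrite lt_neqAle dotpi_ge0// andbT eq_sym; apply/eqP => /(dotpi_eq0 p0).
    exact: zn0.
  have s0 : 0 < Num.sqrt q by rewrite sqrtr_gt0.
  pose v : 'rV[R]_n := \row_i ((Num.sqrt q)^-1 * z i).
  have vE : v 0 = (fun i => (Num.sqrt q)^-1 * z i).
    by apply/funext => i; rewrite mxE.
  exists v.
    rewrite inE; split; rewrite vE.
      rewrite dotpiZr dotpiC dotpiZr -/q -{3}(sqr_sqrtr (ltW q0)).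
      by field; rewrite gt_eqF.
    by rewrite wmeanE dotpiZr -wmeanE z0 mulr0.
  exists (Num.sqrt q) => //; rewrite vE; apply/funext => i.
  by rewrite mulrA divff ?gt_eqF// mul1r.
have [|||v vK vmax] := @EVT_max_rV _ _
    (fun v : 'rV[R]_n => dotpi pi (avg P (v 0)) (avg P (v 0))) K.
- by have [v vK _] := normalize y y0 yn0; exists v; exact: set_mem.
- exact: meanzero_sphere_compact.
- apply: continuous_subspaceT.
  by apply: dotpi_continuous => i; exact: avg_continuous.
move: vK; rewrite inE => -[v1 v0].
set x := v 0 in v1 v0 vmax; set mu := dotpi pi (avg P x) (avg P x) in vmax.
have max z : wmean pi z = 0 ->
    dotpi pi (avg P z) (avg P z) <= mu * dotpi pi z z.
  move=> z0; have [->|zn0] := pselect (z = fun=> 0).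
    by rewrite avg_cst// /dotpi !big1 ?mulr0// => i _; rewrite !mulr0.
  have [u uK [c c0 ->]] := normalize z z0 zn0.
  have := vmax u uK; move: uK; rewrite inE => -[u1 _].
  rewrite avgZ !dotpiZr dotpiC dotpiZr [X in mu * X](_ : _ = c ^+ 2); last first.
    by rewrite dotpiC dotpiZr u1 mulr1.
  by move=> h; rewrite mulrA -expr2 mulrC ler_pM2r// exprn_gt0.
apply: le_trans (max y y0) _; rewrite ler_wpM2r ?dotpi_ge0//.
(* [z] is half the gradient at [x] of the form [v |-> mu |v|^2 - |P v|^2], which
   is nonnegative on mean-zero functions and vanishes at [x]; along [x + t z] its
   linear coefficient is [2 |z|^2]. *)
pose z i := mu * x i + (-1) * avg P (avg P x) i.
have z0 : wmean pi z = 0.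
  by rewrite wmeanE dotpiDr !dotpiZr -!wmeanE !wmean_avg// v0; ring.
have /(dotpi_eq0 p0) zE : dotpi pi z z = 0.
  have zz : mu * dotpi pi x z - dotpi pi (avg P x) (avg P z) = dotpi pi z z.
    rewrite -dotpi_avg// (dotpiC pi x) (dotpiC pi _ z).
    by rewrite [RHS]dotpiDr !dotpiZr mulN1r.
  apply: (@ge0_quad_linear0
    (mu * dotpi pi z z - dotpi pi (avg P z) (avg P z))) => [|t].
    by rewrite subr_ge0 max.
  have h : wmean pi (fun i => x i + t * z i) = 0.
    by rewrite wmeanE dotpiDr dotpiZr -!wmeanE v0 z0; ring.
  have := max _ h; rewrite avgD avgZ (dotpi_quad pi x z) dotpi_quad v1 -/mu.
  by move=> {}h; rewrite -{1}zz; nra.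
have xE i : avg P (avg P x) i = mu * x i.
  by have := congr1 (fun f => f i) zE; rewrite /z => /eqP; rewrite mulN1r subr_eq0 => /eqP.
have mu0 : 0 <= mu by exact: dotpi_ge0.
have xn0 : x <> (fun=> 0).
  by move=> xE0; move: v1; rewrite xE0 /dotpi big1 => [/eqP|i _];
    rewrite ?mulr0// eq_sym oner_eq0.
pose a := Num.sqrt mu; have a2 : a ^+ 2 = mu by rewrite sqr_sqrtr.
rewrite -a2 -(@real_normK _ a) ?num_real//.
suff : `|a| <= lambda_star P.
  by move=> h; rewrite ler_sqr// nnegrE// (le_trans _ h).
pose w i := avg P x i + a * x i.
have [wE|wn0] := pselect (w = fun=> 0).
  rewrite -normrN; apply: (meanzero_eigen_le_lambda_star tP irr rev p0 v0 xn0).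
  apply/funext => i; have := congr1 (fun f => f i) wE; rewrite /w => /eqP.
  by rewrite addr_eq0 mulNr => /eqP.
apply: (meanzero_eigen_le_lambda_star tP irr rev p0 _ wn0).
  by rewrite wmeanE dotpiDr dotpiZr -!wmeanE wmean_avg// v0; ring.
rewrite /w avgD avgZ; apply/funext => i.
by rewrite xE -a2; ring.
Qed.

(** * The variance after one update *)

Definition upd P (o : option 'I_n) y : 'I_n -> R :=
  fun i => if o == Some i then avg P y i else y i.

Lemma wvar_ge0 pi y : (forall i, 0 <= pi i) -> 0 <= wvar pi y.
Proof. by move=> p0; apply: sumr_ge0 => i _; rewrite mulr_ge0 ?sqr_ge0. Qed.

Lemma wvarE pi y : probability_vector pi ->
  wvar pi y = dotpi pi y y - wmean pi y ^+ 2.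
Proof.
move=> [_ p1]; set m := wmean pi y.
transitivity (\sum_(i < n) (pi i * y i * y i - 2 * m * (pi i * y i) + m ^+ 2 * pi i)).
  by apply: eq_bigr => i _; rewrite -/m; ring.
rewrite big_split /= sumrB -!mulr_sumr p1 -/(dotpi pi y y) -/(wmean pi y) -/m.
by ring.
Qed.

Lemma wvar_shift pi y c : probability_vector pi ->
  wvar pi (fun i => y i - c) = wvar pi y.
Proof.
move=> [_ p1]; rewrite /wvar; suff -> : wmean pi (fun i => y i - c) = wmean pi y - c.
  by apply: eq_bigr => i _; congr (_ * _ ^+ 2); ring.
rewrite /wmean; under eq_bigr do rewrite mulrBr.
by rewrite sumrB -mulr_suml p1 mul1r.
Qed.

Lemma upd_shift P o y c : transition_matrix P ->
  upd P o (fun i => y i - c) = (fun i => upd P o y i - c).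
Proof.
move=> tP; apply/funext => i; rewrite /upd; case: ifP => // _.
by rewrite avgD (avg_cst (- c)).
Qed.

Lemma dotpi_upd P pi y k :
  dotpi pi (upd P (Some k) y) (upd P (Some k) y) =
  dotpi pi y y + pi k * (avg P y k ^+ 2 - y k ^+ 2).
Proof.
rewrite /dotpi (bigD1 k)//= [in RHS](bigD1 k)//= /upd eqxx.
have -> : \sum_(i < n | i != k)
    pi i * (if Some k == Some i then avg P y i else y i) *
    (if Some k == Some i then avg P y i else y i) =
  \sum_(i < n | i != k) pi i * y i * y i.
  by apply: eq_bigr => i ik; rewrite (inj_eq Some_inj) eq_sym (negbTE ik).
by ring.
Qed.

(** For mean-zero [y], summing the change of the second moment over all updates
    gives exactly [|P y|^2 - |y|^2], which the spectral bound controls; dropping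
    the squared mean after the update only helps. *)
Lemma sum_wvar_upd P pi y : transition_matrix P -> irreducible P ->
  probability_vector pi -> reversible P pi ->
  \sum_(k < n) wvar pi (upd P (Some k) y) <= (n%:R - two_step_gap P) * wvar pi y.
Proof.
move=> tP irr pp rev; have p0 := stationary_gt0 irr pp rev.
pose z i := y i - wmean pi y.
have z0 : wmean pi z = 0.
  rewrite /wmean /z; under eq_bigr do rewrite mulrBr.
  by rewrite sumrB -mulr_suml pp.2 mul1r subrr.
rewrite -(wvar_shift y (wmean pi y) pp) -/z.
under eq_bigr do rewrite -(wvar_shift _ (wmean pi y) pp) -upd_shift// -/z.
rewrite [in leRHS]wvarE// z0 expr0n subr0.
apply: (@le_trans _ _ (\sum_(k < n) (dotpi pi z z + pi k * (avg P z k ^+ 2 - z k ^+ 2)))).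
  by apply: ler_sum => k _; rewrite wvarE// dotpi_upd gerBl sqr_ge0.
rewrite big_split /= sumr_const card_ord.
have -> : \sum_(k < n) pi k * (avg P z k ^+ 2 - z k ^+ 2) =
    dotpi pi (avg P z) (avg P z) - dotpi pi z z.
  by rewrite /dotpi -sumrB; apply: eq_bigr => k _; ring.
have := avg_contraction tP irr rev p0 z0.
by rewrite -mulr_natl /two_step_gap; lra.
Qed.

(** * Paths of updates and their weights *)

(** A path lists the updated sites, one for each step of time, with [None] for a
    step without update.  The last step is at the head of the list, so that the
    index of a step is the length of the tail that follows it. *)
Fixpoint run P (a : seq (option 'I_n)) y : 'I_n -> R :=
  if a is o :: a' then upd P o (run P a' y) else y.

Definition moves : seq (option 'I_n) := None :: [seq Some k | k <- enum 'I_n].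

Fixpoint paths (m : nat) : seq (seq (option 'I_n)) :=
  if m is m'.+1 then [seq o :: a | a <- paths m', o <- moves] else [:: [::]].

(** The probability that the rings of [n] independent unit Poisson clocks in
    consecutive steps of lengths [h 0], [h 1], ... follow the path [a]: in a step
    of length [h] this is [exp(- n h)] for no ring at all, and [h exp(- n h)] for
    a single ring at a given site. *)
Fixpoint weight (h : nat -> R) (a : seq (option 'I_n)) : R :=
  if a is o :: a' then
    weight h a' * (h (size a') ^+ (o != None) * expR (- (n%:R * h (size a'))))
  else 1.

Lemma big_moves (V : nmodType) (F : option 'I_n -> V) :
  \sum_(o <- moves) F o = F None + \sum_(k < n) F (Some k).
Proof. by rewrite big_cons big_map big_enum. Qed.

Lemma big_paths (V : nmodType) m (F : seq (option 'I_n) -> V) :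
  \sum_(a <- paths m.+1) F a =
  \sum_(a <- paths m) \sum_(o <- moves) F (o :: a).
Proof.
rewrite /= big_flatten big_map; apply: eq_bigr => a _.
by rewrite -(big_map (cons^~ a) xpredT F).
Qed.

Lemma size_paths m a : a \in paths m -> size a = m.
Proof.
elim: m a => [|m IH] a /=; first by rewrite inE => /eqP ->.
move=> /flatten_mapP[b /IH bm ab].
by have /mapP[c _ ->] : a \in [seq o :: b | o <- moves] by []; rewrite /= bm.
Qed.

Lemma weight_ge0 (h : nat -> R) a : (forall i, 0 <= h i) -> 0 <= weight h a.
Proof.
move=> h0; elim: a => //= o a IH.
by rewrite !mulr_ge0 ?exprn_ge0 ?expR_ge0.
Qed.

Lemma sum_weight h m :
  \sum_(a <- paths m) weight h a =
  \prod_(i < m) (expR (- (n%:R * h i)) * (1 + n%:R * h i)).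
Proof.
elim: m => [|m IH]; first by rewrite big_seq1 big_ord0.
rewrite big_paths big_ord_recr /= -IH mulr_suml !big_seq.
apply: eq_bigr => a /size_paths am; rewrite big_moves /= am expr0 expr1 mul1r.
by rewrite sumr_const card_ord -mulr_natl; ring.
Qed.

(** The missing mass is that of two or more rings in some step; in a step of
    length [h] it is at most [(n h)^2], since
    [exp(- x) (1 + x) >= (1 - x) (1 + x) = 1 - x^2]. *)
Lemma sum_weight_ge (h : nat -> R) m : (forall i, 0 <= h i) ->
  1 - \sum_(i < m) (n%:R * h i) ^+ 2 <= \sum_(a <- paths m) weight h a <= 1.
Proof.
move=> h0; rewrite sum_weight.
elim: m => [|m /andP[IH1 IH2]]; first by rewrite !big_ord0 subr0 lexx.
rewrite !big_ord_recr /=; set x := n%:R * h m.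
have x0 : 0 <= x by rewrite mulr_ge0.
have q1 : expR (- x) * (1 + x) <= 1.
  by rewrite expRN mulrC ler_pdivrMr ?expR_gt0// mul1r expR_ge1Dx.
have q2 : 1 - x ^+ 2 <= expR (- x) * (1 + x).
  apply: (@le_trans _ _ ((1 - x) * (1 + x))); first by lra.
  by rewrite ler_wpM2r ?addr_ge0// expR_ge1Dx.
have q0 : 0 <= expR (- x) * (1 + x) by rewrite mulr_ge0 ?addr_ge0// expR_ge0.
have p0 : 0 <= \prod_(i < m) (expR (- (n%:R * h i)) * (1 + n%:R * h i)).
  by apply: prodr_ge0 => i _; rewrite mulr_ge0 ?addr_ge0 ?mulr_ge0 ?expR_ge0.
move: IH1 IH2 q0 q1 q2 p0.
move: (\sum_(_ < _) _) (\prod_(_ < _) _) (expR _ * _) => S p q.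
by move=> *; apply/andP; split; nra.
Qed.

(** One step multiplies the expected variance by at most
    [exp (- n h) (1 + (n - gap) h) <= exp (- gap h)]. *)
Lemma sum_weight_wvar P pi y (h : nat -> R) m : transition_matrix P -> irreducible P ->
  probability_vector pi -> reversible P pi -> (forall i, 0 <= h i) ->
  \sum_(a <- paths m.+1) weight h a * wvar pi (run P a y) <=
  expR (- (two_step_gap P * h m)) *
    \sum_(a <- paths m) weight h a * wvar pi (run P a y).
Proof.
move=> tP irr pp rev h0; rewrite big_paths mulr_sumr !big_seq.
apply: ler_sum => a /size_paths am; rewrite big_moves /= am expr0 mul1r.
rewrite -/(upd P None _) (_ : upd P None _ = run P a y)//.
under eq_bigr do rewrite expr1.
rewrite -mulr_sumr; set e := expR (- (n%:R * h m)).
have := sum_wvar_upd (run P a y) tP irr pp rev.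
set S := \sum_(k < n) _; set V := wvar pi _; set g := two_step_gap P => SV.
have V0 : 0 <= V by apply: wvar_ge0; exact: pp.1.
have -> : weight h a * e * V + weight h a * (h m * e) * S =
  weight h a * (e * (V + h m * S)) by ring.
rewrite [leRHS]mulrCA ler_wpM2l ?weight_ge0//.
apply: (@le_trans _ _ (e * (V * expR ((n%:R - g) * h m)))).
  rewrite ler_wpM2l ?expR_ge0//.
  apply: (@le_trans _ _ (V * (1 + (n%:R - g) * h m))).
    by rewrite mulrDr mulr1 lerD2l (le_trans (ler_wpM2l (h0 m) SV))//; lra.
  by rewrite ler_wpM2l// expR_ge1Dx.
rewrite mulrCA -expRD mulrC ler_wpM2r// ler_expR; lra.
Qed.

End chain.

(** * Sample paths of the smoothing process *)

Section pathwise.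
Context {d : measure_display} {T : measurableType d} {R : realType}.
Implicit Types (M : R -> T -> nat) (w : T).

Definition counting_path M w :=
  (forall s t : R, 0 <= s -> s <= t -> (M s w <= M t w)%N) /\
  (forall t : R, 0 <= t -> M u w @[u --> t^'+] --> M t w).

Lemma no_ring M w (u v : R) : counting_path M w -> 0 <= u -> M v w = M u w ->
  forall r, u < r -> r <= v -> ~ rings M w r.
Proof.
move=> [mono _] u0 e r ur rv [_ /(_ u u0 ur)].
by have := mono r v (le_trans u0 (ltW ur)) rv; rewrite e; lia.
Qed.

(** The ring time [r] is the infimum of the times at which the new value has been
    reached; it is attained because the path is right-continuous and integer
    valued. *)
Lemma single_ring M w (u v : R) : counting_path M w -> 0 <= u -> u <= v ->
  M v w = (M u w).+1 ->
  exists r, [/\ u < r, r <= v, rings M w r, M v w = M r w &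
    forall x, u <= x -> x < r -> M x w = M u w].
Proof.
move=> [mono rc] u0 uv e.
pose E : set R := [set x | [/\ u <= x, x <= v & M x w = M v w]].
have Ev : E v by split.
have lbE : has_lbound E by exists u => x [].
have infE : has_inf E by split => //; exists v.
pose r := inf E.
have ur : u <= r by apply: lb_le_inf => [|x []//]; exists v.
have r0 : 0 <= r := le_trans u0 ur.
have rv : r <= v by exact: ge_inf.
have Er : M r w = M v w.
  have : \forall x \near r^'+, M x w = M r w.
    have /(_ [set M r w]) := rc r r0; apply.
    by rewrite nbhs_principalE; apply/principal_filterP.
  move=> [e' /= e0 near_r].
  have [x Ex xr] := inf_adherent e0 infE.
  have [rx|xr'|rx] := ltgtP r x.
  - have [_ _ <-] := Ex; apply/esym; apply: near_r => //=.
    by rewrite ltr_norml; move: xr rx; rewrite -/r; lra.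
  - by have := ge_inf lbE Ex; rewrite -/r leNgt xr'.
  - by have [_ _] := Ex; rewrite rx.
have ur' : u < r.
  rewrite lt_neqAle ur andbT; apply/eqP => h.
  by move: Er; rewrite -h e; lia.
have before x : u <= x -> x < r -> M x w = M u w.
  move=> ux xr; have xv : x <= v by apply: le_trans (ltW xr) rv.
  have h1 := mono u x u0 ux; have h2 := mono x v (le_trans u0 ux) xv.
  have h3 : M x w <> M v w.
    by move=> h; have := ge_inf lbE (And3 ux xv h); rewrite -/r leNgt xr.
  lia.
exists r; split => //; split; first exact: le_lt_trans ur'.
move=> s s0 sr; rewrite Er e ltnS.
have [us|su] := leP u s; first by rewrite before.
by apply: mono => //; exact: ltW.
Qed.

Context {n : nat}.
Variables (P : 'M[R]_n) (M : 'I_n -> R -> T -> nat) (Z : R -> 'I_n -> T -> R).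

Definition smoothing_path w :=
  [/\ forall k, counting_path (M k) w,
      forall (k : 'I_n) (t : R), rings (M k) w t ->
        Z t k w = \sum_(j < n) P k j * lim (Z s j w @[s --> t^'-]) &
      forall (k : 'I_n) (s t : R), 0 <= s -> s <= t ->
        (forall u, s < u -> u <= t -> ~ rings (M k) w u) -> Z t k w = Z s k w].

(** All values are constant on [u, r[, where [r] is the only ring time in the
    step, so that the left limits in the update rule are the values at [u]. *)
Lemma smoothing_step w (u v : R) (o : option 'I_n) :
  smoothing_path w -> 0 <= u -> u <= v ->
  (forall k, (M k v w - M k u w)%N = (o == Some k)) ->
  Z v ^~ w = upd P o (Z u ^~ w).
Proof.
move=> [cM ring cst] u0 uv e.
have E k : M k v w = (M k u w + (o == Some k))%N.
  by have := (cM k).1 u v u0 uv; have := e k; lia.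
have still k x : u <= x -> x <= v -> M k x w = M k u w -> Z x k w = Z u k w.
  by move=> ux xv h; apply: cst => // r; apply: no_ring (cM k) u0 h r.
apply/funext => k; rewrite /upd; have := E k; case: eqP => [ok|_]; last first.
  by rewrite addn0 => h; apply: still.
rewrite addn1 => /(single_ring (cM k) u0 uv)[r [ur rv rr Mr before]].
have -> : Z v k w = Z r k w.
  apply: cst => //; first exact: le_trans (ltW ur).
  by apply: no_ring (cM k) _ Mr; exact: le_trans (ltW ur).
rewrite (ring k r rr); apply: eq_bigr => j _; congr (_ * _).
apply: cvg_lim => //; apply: cvg_near_cst.
near=> x.
have ux : u <= x by apply/ltW; near: x; exact: nbhs_left_gt.
have xr : x < r by near: x; exact: nbhs_left_lt.
have xv : x <= v by apply: le_trans (ltW xr) rv.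
apply: still => //.
have [jk|jk] := eqVneq j k; first by rewrite jk before.
have := E j; rewrite ok (inj_eq Some_inj) eq_sym (negbTE jk) addn0.
have := (cM j).1 u x u0 ux; have := (cM j).1 x v (le_trans u0 ux) xv.
lia.
Unshelve. all: by end_near.
Qed.

(** The boolean [o == Some k] is read as 0 or 1: the clock named by [o] rings
    exactly once in the step, and the others do not ring. *)
Fixpoint cell (t : nat -> R) (a : seq (option 'I_n)) : set T :=
  if a is o :: a' then
    cell t a' `&` [set w | forall k : 'I_n,
      (M k (t (size a').+1) w - M k (t (size a')) w)%N = (o == Some k)]
  else setT.

Lemma smoothing_run w (t : nat -> R) a :
  t 0%N = 0 -> {homo t : i j / (i <= j)%N >-> i <= j} ->
  smoothing_path w -> cell t a w -> Z (t (size a)) ^~ w = run P a (Z 0 ^~ w).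
Proof.
move=> t0 tm sw; elim: a => [|o a IH] /=; first by rewrite t0.
move=> [/IH <- e]; apply: smoothing_step => //; last exact: tm.
by rewrite -t0; exact: tm.
Qed.

End pathwise.

(** * Independence *)

Section independence.
Context {d : measure_display} {T : measurableType d} {R : realType}.
Variable Pr : probability T R.

(** Restricting [X] to [E] multiplies its law by [Pr E], except at 0, which
    receives the remaining mass but does not contribute to the integral.  The laws
    are therefore compared on the positive half-line only. *)
Lemma integral_indep (X : T -> R) (E : set T) :
  measurable_fun setT X -> (forall w, 0 <= X w) -> measurable E ->
  (forall B, measurable B -> Pr (X @^-1` B `&` E) = (Pr (X @^-1` B) * Pr E)%E) ->
  (\int[Pr]_(w in E) (X w)%:E = Pr E * \int[Pr]_w (X w)%:E)%E.
Proof.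
move=> mX X0 mE ind.
pose X' : T -> R := X \_ E.
have mX' : measurable_fun setT X' by exact/(measurable_restrictT _ mE)/measurable_funTS.
have X'0 w : 0 <= X' w by rewrite /X' patchE; case: ifP.
pose D : set R := `]0, +oo[%classic.
have mD : measurable D by exact: measurable_itv.
have posE (Z : T -> R) : measurable_fun setT Z -> (forall w, 0 <= Z w) ->
    (\int[Pr]_w (Z w)%:E = \int[pushforward Pr Z]_(y in D) y%:E)%E.
  move=> mZ Z0; rewrite ge0_integral_pushforward//; last first.
    by move=> y; rewrite inE /D /= in_itv/= andbT lee_fin => /ltW.
  rewrite [RHS]integral_mkcond; apply: eq_integral => w _.
  rewrite patchE; case: ifPn => //; rewrite notin_setE /D /= in_itv/= andbT.
  by move=> /negP; rewrite -leNgt => Zw; congr EFin; apply/eqP; rewrite eq_le Zw Z0.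
rewrite integral_mkcond (_ : (_ \_ _)%E = EFin \o X'); last first.
  by apply/funext => w; rewrite /X' /= !patchE; case: ifP.
rewrite /comp posE// posE//.
have E_ge0 : (0 <= fine (Pr E))%R by rewrite fine_ge0.
have -> : Pr E = ((NngNum E_ge0)%:num)%:E.
  by rewrite /= fineK// fin_num_measure.
pose XX : {mfun T >-> R} := HB.pack X (isMeasurableFun.Build _ _ _ _ X mX).
pose XX' : {mfun T >-> R} := HB.pack X' (isMeasurableFun.Build _ _ _ _ X' mX').
rewrite -(ge0_integral_mscale (pushforward Pr XX))//; last first.
  by move=> y; rewrite /D /= in_itv/= andbT lee_fin => /ltW.
apply: (@eq_measure_integral _ _ _ _ _ (pushforward Pr XX')) => A mA AD.
rewrite /= /mscale /pushforward /= fineK ?fin_num_measure// muleC -ind//.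
congr (Pr _); apply/seteqP; split => w /=; rewrite /X' patchE; last first.
  by case=> ? wE; rewrite mem_set.
case: ifPn => [wE|_ /AD]; first by split => //; exact: set_mem.
by rewrite /D /= in_itv/= ltxx.
Qed.

(** The formula covers [s = t], where the increment is 0 and [0 ^+ b] is 1 or 0;
    this admits grids with steps of length 0. *)
Lemma clock_increment_prob (M : R -> {RV Pr >-> nat}) (s t : R) (b : bool) :
  poisson_clock M -> 0 <= s -> s <= t ->
  Pr [set w | (M t w - M s w)%N = b] = ((t - s) ^+ b * expR (- (t - s)))%:E.
Proof.
move=> cM s0; rewrite le_eqVlt => /predU1P[<-|st]; last first.
  rewrite (clock_poisson cM)// /poisson_pmf subr_gt0 st; congr EFin.
  by case: b; rewrite ?fact0 ?factS ?muln1 invr1 mulr1.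
rewrite subrr oppr0 expR0 mulr1; case: b => /=.
  rewrite expr1 (_ : [set _ | _] = set0) ?measure0//.
  by apply/seteqP; split => w //=; rewrite subnn.
rewrite expr0 (_ : [set _ | _] = setT) ?probability_setT//.
by apply/seteqP; split => w //= _; rewrite subnn.
Qed.

Lemma measurable_subn_eq d' (U : measurableType d') (f g : U -> nat) (c : nat) :
  measurable_fun setT f -> measurable_fun setT g ->
  measurable [set w | (f w - g w)%N = c].
Proof.
move=> mf mg; rewrite (_ : [set _ | _] = setT `&` (fun w => (f w - g w)%N) @^-1` [set c]).
  by apply: measurable_fun_subn => //; exact: measurableT.
by rewrite setTI.
Qed.

Lemma sigma_gen_preimage d' (U : measurableType d') (I : Type) (D : set I)
    (X : I -> T -> U) i (B : set U) :
  D i -> measurable B -> sigma_gen D X (X i @^-1` B).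
Proof.
by move=> Di mB; apply: sub_sigma_algebra; exists i => //; exists B; rewrite ?setTI.
Qed.

Lemma measurable_sigma_gen d' (U : measurableType d') (I : Type) (D : set I)
    (X : I -> T -> U) i : D i ->
  @measurable_fun _ _ (g_sigma_algebraType
    (\bigcup_(i in D) preimage_set_system setT (X i) measurable)) U setT (X i).
Proof.
by move=> Di _ B mB; rewrite setTI; exact: sigma_gen_preimage.
Qed.

Lemma clock_increments_prob (M : R -> {RV Pr >-> nat}) (t : nat -> R) m
    (b : 'I_m -> bool) :
  poisson_clock M -> 0 <= t 0%N -> {homo t : i j / (i <= j)%N >-> i <= j} ->
  Pr (\bigcap_(i in [set: 'I_m]) [set w | (M (t i.+1) w - M (t i) w)%N = b i]) =
  (\prod_(i < m) ((t i.+1 - t i) ^+ b i * expR (- (t i.+1 - t i))))%:E.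
Proof.
move=> cM t0 tm.
have t_ge0 i : 0 <= t i by apply: le_trans (tm 0%N i _).
have := @clock_indep_incr _ _ _ _ _ cM m t t0 (fun i _ => tm _ _ (leqnSn i)).
move=> /(_ (fun i => [set w | (M (t i.+1) w - M (t i) w)%N = b i])).
move=> /(_ _ [set: 'I_m]%SET) ind.
rewrite (_ : [set: 'I_m] = [set` [set: 'I_m]%SET]); last first.
  by apply/seteqP; split => i _ //=; rewrite inE.
rewrite ind; last first.
  move=> i; exact: (@sigma_gen_preimage _ _ _ [set: unit]
    (fun _ w => (M (t i.+1) w - M (t i) w)%N) tt [set (b i : nat)]).
rewrite -prodEFin; apply: eq_big => [i|i _]; first by rewrite inE.
by apply: clock_increment_prob => //; exact: tm.
Qed.

End independence.

(** * Probabilities of ring patterns *)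

Section cells.
Context {d : measure_display} {T : measurableType d} {R : realType} {n : nat}.

Lemma nth_rev_cons (a : seq (option 'I_n)) o i :
  nth None (rev (o :: a)) i =
  if (i < size a)%N then nth None (rev a) i else if i == size a then o else None.
Proof. by rewrite rev_cons nth_rcons size_rev. Qed.

Lemma cellP (M : 'I_n -> R -> T -> nat) (t : nat -> R) a w :
  cell M t a w <-> forall k i, (i < size a)%N ->
    (M k (t i.+1) w - M k (t i) w)%N = (nth None (rev a) i == Some k).
Proof.
elim: a => [|o a IH] /=; first by split.
split=> [[/IH h e] k i|h].
  rewrite nth_rev_cons ltnS leq_eqVlt => /predU1P[->|ia].
    by rewrite ltnn eqxx.
  by rewrite ia h.
split; first apply/IH => k i ia.
  by rewrite h ?nth_rev_cons ?ia// ltnS ltnW.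
by move=> k; rewrite h// nth_rev_cons ltnn eqxx.
Qed.

(** In one step, all clocks contribute the silence factor [exp(- h)], and the
    clock that rings, if any, a factor [h]. *)
Lemma prod_clocks (h : R) (o : option 'I_n) :
  \prod_(k < n) (h ^+ (o == Some k) * expR (- h)) =
  h ^+ (o != None) * expR (- (n%:R * h)).
Proof.
rewrite big_split /= prodr_const card_ord -expRM_natl mulrN; congr (_ * _).
case: o => [k|]; last by rewrite big1.
rewrite (bigD1 k)//= eqxx big1 ?mulr1// => j jk.
by rewrite (inj_eq Some_inj) eq_sym (negbTE jk) expr0.
Qed.

Lemma weightE (h : nat -> R) (a : seq (option 'I_n)) :
  weight h a = \prod_(k < n) \prod_(i < size a)
    (h i ^+ (nth None (rev a) i == Some k) * expR (- h i)).
Proof.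
rewrite exchange_big /=; elim: a => [|o a IH]; first by rewrite big_ord0.
rewrite [RHS]big_ord_recr /= IH prod_clocks nth_rev_cons ltnn eqxx; congr (_ * _).
by apply: eq_bigr => i _; apply: eq_bigr => k _; rewrite nth_rev_cons ltn_ord.
Qed.

Variable Pr : probability T R.
Variables (P : 'M[R]_n) (N : 'I_n -> R -> {RV Pr >-> nat})
  (Y : R -> 'I_n -> {RV Pr >-> R}).
Hypothesis NY : smoothing_process P N Y.
Variable t : nat -> R.
Hypothesis t0 : t 0%N = 0.
Hypothesis tm : {homo t : i j / (i <= j)%N >-> i <= j}.

Local Notation ring_cell := (cell (fun k u w => N k u w) t).

Let clock_cell (a : seq (option 'I_n)) k : set T :=
  \bigcap_(i in [set: 'I_(size a)])
    [set w | (N k (t i.+1) w - N k (t i) w)%N = (nth None (rev a) i == Some k)].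

Let ring_cellE a : ring_cell a = \bigcap_(k in [set: 'I_n]) clock_cell a k.
Proof.
apply/seteqP; split => w.
  by move=> /cellP h k _ i _; exact: h.
by move=> h; apply/cellP => k i ia; exact: (h k I (Ordinal ia) I).
Qed.

Let grid_ge0 i : 0 <= t i. Proof. by rewrite -t0 tm. Qed.

Lemma measurable_cell a : measurable (ring_cell a).
Proof.
rewrite ring_cellE; apply: fin_bigcap_measurable => // k _.
apply: fin_bigcap_measurable => // i _.
by apply: measurable_subn_eq; exact: measurable_funPT.
Qed.

Let clock_cell_sigma a k :
  sigma_gen [set u : R | 0 <= u] (N k) (clock_cell a k).
Proof.
rewrite /sigma_gen; set G := \bigcup_(_ in _) _.
have : @measurable _ (g_sigma_algebraType G) (clock_cell a k).
  apply: fin_bigcap_measurable => // i _.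
  by apply: measurable_subn_eq; apply: measurable_sigma_gen; exact: grid_ge0.
by [].
Qed.

(** The three kinds of independence meet here: of the initial configuration from
    the clocks, of the clocks from each other, and of the increments of one clock
    in successive steps. *)
Lemma cell_indep a (B : set T) : sigma_gen [set: 'I_n] (Y 0) B ->
  (Pr (B `&` ring_cell a) = Pr B * (weight (fun i => t i.+1 - t i) a)%:E)%E.
Proof.
move=> YB.
have := smoothing_indep NY.
move=> /(_ (fun o => if o is Some k then clock_cell a k else B)) ind.
have {ind} := ind _ [set: option 'I_n]%SET.
have -> : \bigcap_(i in [set` [set: option 'I_n]%SET])
    (if i is Some k then clock_cell a k else B) = B `&` ring_cell a.
  rewrite ring_cellE; apply/seteqP; split => w /=.
    move=> h; split; first by apply: (h None); rewrite /= inE.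
    by move=> k _; apply: (h (Some k)); rewrite /= inE.
  by move=> [Bw h] [k|] _ //; exact: h.
move=> ->; last by (case=> [k|//]; exact: clock_cell_sigma).
rewrite (bigD1 None) ?inE//=; congr (_ * _)%E.
rewrite weightE -prodEFin.
rewrite (reindex_omap (Some : 'I_n -> _) id)/=; last by (case=> //; rewrite eqxx andbF).
apply: eq_big => [k|k _]; first by rewrite inE eqxx.
apply: (@clock_increments_prob _ _ _ _ _ _ _
  (fun i => nth None (rev a) i == Some k)); rewrite ?t0//.
exact: smoothing_clock NY k.
Qed.

End cells.

(** * Expectation of the variance along a grid *)

Lemma sum_unique_le1 (R : realType) (X : eqType) (s : seq X) (g : pred X) :
  uniq s -> (forall x y, x \in s -> y \in s -> g x -> g y -> x = y) ->
  \sum_(x <- s) (g x)%:R <= 1 :> R.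
Proof.
move=> us inj; have [/hasP[x xs gx]|/hasPn ng] := boolP (has g s).
  rewrite (bigD1_seq x)//= gx big_seq_cond big1 ?addr0// => y /andP[ys yx].
  case: (boolP (g y)) => // gy.
  by move: yx; rewrite (inj y x) ?eqxx.
by rewrite big_seq big1 ?ler01// => x /ng /negbTE ->.
Qed.

Lemma uniq_paths n m : uniq (@paths n m).
Proof.
elim: m => [//|m IH].
apply: (@allpairs_uniq _ _ _ (fun a o => o :: a)) => //.
  rewrite /moves /= map_inj_uniq ?enum_uniq ?andbT; last exact: Some_inj.
  by apply/mapP => -[].
by move=> [a o] [b o'] _ _ /= [-> ->].
Qed.

Section measurability.
Context {d : measure_display} {T : measurableType d} {R : realType} {n : nat}.

Lemma measurable_wvar (pi : 'I_n -> R) (y : 'I_n -> T -> R) :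
  (forall i, measurable_fun setT (y i)) ->
  measurable_fun setT (fun w => wvar pi (y ^~ w)).
Proof.
move=> my; apply: measurable_sum => i; apply: measurable_funM => //.
apply: measurable_funX; apply: measurable_funB => //.
by apply: measurable_sum => j; apply: measurable_funM.
Qed.

Lemma measurable_run (P : 'M[R]_n) a (y : 'I_n -> T -> R) :
  (forall i, measurable_fun setT (y i)) ->
  forall i, measurable_fun setT (fun w => run P a (y ^~ w) i).
Proof.
move=> my; elim: a => [//|o a IH] i /=; rewrite /upd.
case: (o == Some i) => //.
by apply: measurable_sum => j; apply: measurable_funM.
Qed.

Lemma cell_inj (M : 'I_n -> R -> T -> nat) t a b w : size a = size b ->
  cell M t a w -> cell M t b w -> a = b.
Proof.
elim: a b => [|o a IH] [|o' b]//= [sab] [ca oa] [cb ob].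
rewrite -(IH b)//; congr (_ :: _).
move: oa ob => /= oa; rewrite -sab => ob.
have e k : (o == Some k) = (o' == Some k).
  by apply: (can_inj oddb); rewrite -oa -ob.
case: o e {oa} => [k|] e; first by apply/esym/eqP; rewrite -e.
by case: o' e {ob} => [k|//] /(_ k); rewrite eqxx.
Qed.

End measurability.

Section expectation.
Context {d : measure_display} {T : measurableType d} {R : realType} {n : nat}.
Variable Pr : probability T R.
Variables (P : 'M[R]_n) (pi : 'I_n -> R) (N : 'I_n -> R -> {RV Pr >-> nat})
  (Y : R -> 'I_n -> {RV Pr >-> R}).
Hypothesis P_trans : transition_matrix P.
Hypothesis P_irr : irreducible P.
Hypothesis pi_prob : probability_vector pi.
Hypothesis P_rev : reversible P pi.
Hypothesis NY : smoothing_process P N Y.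

Let V := variance_functional pi Y.

Lemma ae_smoothing_path :
  {ae Pr, forall w, smoothing_path P (fun k u w => N k u w) (fun u k w => Y u k w) w}.
Proof.
have ae_filter : Filter (nbhs (almost_everywhere Pr)).
  exact: ae_filter_ringOfSetsType.
have h k : {ae Pr, forall w, counting_path (fun u w => N k u w) w}.
  have [_ h1 h2 _ _] := smoothing_clock NY k.
  by apply: filterS2 h1 h2 => w ? ?; split.
near=> w; split; near: w.
- exact: filter_forall h.
- exact: smoothing_update NY.
- exact: smoothing_const NY.
Unshelve. all: by end_near. Qed.

Let pi_ge0 i : 0 <= pi i. Proof. by case: pi_prob. Qed.

Lemma measurable_V u : measurable_fun setT (V u).
Proof. by apply: measurable_wvar => i; exact: measurable_funPT. Qed.

Lemma V_ge0 u w : 0 <= V u w. Proof. exact: wvar_ge0. Qed.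

Variable t : nat -> R.
Hypothesis t0 : t 0%N = 0.
Hypothesis tm : {homo t : i j / (i <= j)%N >-> i <= j}.
Let h i := t i.+1 - t i.
Let h_ge0 i : 0 <= h i. Proof. by rewrite subr_ge0 tm. Qed.

Local Notation ring_cell := (cell (fun k u w => N k u w) t).

Let mcell a : measurable (ring_cell a). Proof. exact: (measurable_cell N t). Qed.

Lemma cell_prob a : Pr (ring_cell a) = (weight h a)%:E.
Proof.
have := cell_indep NY t0 tm a (B := setT).
rewrite setTI probability_setT mul1e; apply.
exact: (@measurableT _ (g_sigma_algebraType _)).
Qed.

Let run_var a (w : T) := wvar pi (run P a (fun i => Y 0 i w)).

Let measurable_run_var a : measurable_fun setT (run_var a).
Proof.
apply: (@measurable_wvar _ T R n pi (fun i w => run P a (fun j => Y 0 j w) i)).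
by apply: measurable_run => i; exact: measurable_funPT.
Qed.

(** On the cell of [a] the configuration is almost surely [run P a] of the initial
    one, which is independent of the cell. *)
Lemma integral_cell a : (\int[Pr]_(w in ring_cell a) (V (t (size a)) w)%:E =
  (weight h a)%:E * \int[Pr]_w (run_var a w)%:E)%E.
Proof.
rewrite -cell_prob -integral_indep//; last 2 first.
- by move=> w; exact: wvar_ge0.
- move=> B mB; rewrite cell_prob; apply: (cell_indep NY t0 tm).
  rewrite /sigma_gen; set G := \bigcup_(_ in _) _.
  have : @measurable _ (g_sigma_algebraType G) (setT `&` run_var a @^-1` B).
    apply: (@measurable_wvar _ (g_sigma_algebraType G) R n pi
      (fun i w => run P a (fun j => Y 0 j w) i)) => //.
    by apply: measurable_run => i; exact: measurable_sigma_gen.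
  by rewrite setTI.
apply: ge0_ae_eq_integral => //.
- by apply: measurable_funTS; apply/measurable_EFinP; exact: measurable_V.
- by apply: measurable_funTS; apply/measurable_EFinP.
- by move=> w _; rewrite lee_fin V_ge0.
- by move=> w _; rewrite lee_fin wvar_ge0.
apply: filterS ae_smoothing_path => w sw cw; congr EFin.
rewrite /V /variance_functional /run_var.
by rewrite -(smoothing_run t0 tm sw cw).
Qed.

(** The expected variance at [t m] restricted to at most one ring in each step,
    as a function of the initial configuration. *)
Let mean_var m (w : T) := \sum_(a <- paths m) weight h a * run_var a w.

Let sum_integral_cell m :
  (\sum_(a <- paths m) \int[Pr]_(w in ring_cell a) (V (t m) w)%:E =
   \int[Pr]_w (mean_var m w)%:E)%E.
Proof.
under [RHS]eq_integral do rewrite /mean_var -sumEFin.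
rewrite ge0_integral_sum//; last 2 first.
- by move=> a; apply/measurable_EFinP; exact: measurable_funM.
- by move=> a w _; rewrite lee_fin mulr_ge0 ?weight_ge0 ?wvar_ge0.
rewrite big_seq [RHS]big_seq; apply: eq_bigr => a /size_paths am.
rewrite -{1}am integral_cell.
under [RHS]eq_integral do rewrite EFinM.
rewrite ge0_integralZl_EFin ?weight_ge0//.
- by move=> w _; rewrite lee_fin wvar_ge0.
- exact/measurable_EFinP.
Qed.

Let mean_var_ge0 m w : 0 <= mean_var m w.
Proof. by apply: sumr_ge0 => a _; rewrite mulr_ge0 ?weight_ge0 ?wvar_ge0. Qed.

Let measurable_mean_var m : measurable_fun setT (mean_var m).
Proof. by apply: measurable_sum => a; exact: measurable_funM. Qed.

Let mean_var_decay j m w : (j <= m)%N ->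
  mean_var m w <= expR (- two_step_gap P * (t m - t j)) * mean_var j w.
Proof.
elim: m => [|m IH].
  by rewrite leqn0 => /eqP ->; rewrite subrr mulr0 expR0 mul1r.
rewrite leq_eqVlt => /predU1P[->|].
  by rewrite subrr mulr0 expR0 mul1r.
rewrite ltnS => /IH {}IH.
have := sum_weight_wvar (fun i => Y 0 i w) m P_trans P_irr pi_prob P_rev h_ge0.
move=> /le_trans; apply.
apply: le_trans (ler_wpM2l (expR_ge0 _) IH) _.
rewrite mulrA -expRD ler_wpM2r// ler_expR /h; lra.
Qed.

(** The cells of the paths of one length are disjoint, so that this is the
    indicator of their union: at most one ring in each step. *)
Let covered m (w : T) : R := \sum_(a <- paths m) \1_(ring_cell a) w.

Let covered_le1 m w : covered m w <= 1.
Proof.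
have := @sum_unique_le1 R _ (paths m) (fun a => w \in ring_cell a) (uniq_paths n m).
apply=> a b /size_paths sa /size_paths sb; rewrite !inE.
by apply: cell_inj; rewrite sa sb.
Qed.

Let measurable_covered m : measurable_fun setT (covered m).
Proof. by apply: measurable_sum => a; exact: measurable_indic. Qed.

Let sum_integral_covered m (X : T -> R) : measurable_fun setT X ->
  (forall w, 0 <= X w) ->
  (\sum_(a <- paths m) \int[Pr]_(w in ring_cell a) (X w)%:E =
   \int[Pr]_w (X w * covered m w)%:E)%E.
Proof.
move=> mX X0.
under [LHS]eq_bigr do rewrite integral_mkcond epatch_indic.
rewrite -ge0_integral_sum//.
- apply: eq_integral => w _ /=.
  under eq_bigr do rewrite -EFinM.
  by rewrite sumEFin -mulr_sumr.
- move=> a; apply: emeasurable_funM; exact/measurable_EFinP.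
- by move=> a w _ /=; rewrite -EFinM lee_fin mulr_ge0.
Qed.

Let integral_uncovered m :
  (\int[Pr]_w (1 - covered m w)%:E <=
   (\sum_(i < m) (n%:R * h i) ^+ 2)%:E)%E.
Proof.
have /andP[] := sum_weight_ge m h_ge0 (n := n).
set q := \sum_(a <- paths m) _ => hq _.
have e : (\int[Pr]_w (1 - covered m w)%:E + q%:E = 1)%E.
  have -> : (q%:E = \int[Pr]_w (covered m w)%:E)%E.
    under [RHS]eq_integral do rewrite /covered -sumEFin.
    rewrite ge0_integral_sum//; last first.
      by move=> a; apply/measurable_EFinP; exact: measurable_indic.
    rewrite -sumEFin; apply: eq_bigr => a _.
    by rewrite integral_indic// setIT; exact/esym/cell_prob.
  rewrite -ge0_integralD//.
  - under eq_integral do rewrite -EFinD subrK.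
    by rewrite integral_cst//= mul1e probability_setT.
  - by move=> w _; rewrite lee_fin subr_ge0.
  - by apply/measurable_EFinP; exact: measurable_funB.
  - by move=> w _; rewrite lee_fin sumr_ge0.
  - exact/measurable_EFinP.
move: e; case: (\int[Pr]_w _)%E => [r| |]//.
by rewrite -EFinD => -[e]; rewrite lee_fin; lra.
Qed.

(** Outside the cells nothing is known about the variance at [t m], and the
    truncation at [K] bounds it there; inside, the decay of [mean_var] applies.
    At [t j] the restriction to cells is dropped, which only increases the
    right-hand side. *)
Lemma truncated_variance_le (j m : nat) (K : R) : (j <= m)%N -> 0 <= K ->
  (\int[Pr]_w (Num.min (V (t m) w) K)%:E <=
   (expR (- two_step_gap P * (t m - t j)))%:E * \int[Pr]_w (V (t j) w)%:E +
   (K * \sum_(i < m) (n%:R * h i) ^+ 2)%:E)%E.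
Proof.
move=> jm K0.
have mV := measurable_V; have V0 := V_ge0.
have c0 i w : 0 <= covered i w by exact: sumr_ge0.
apply: (@le_trans _ _ (\int[Pr]_w ((V (t m) w * covered m w)%:E +
    (K * (1 - covered m w))%:E))%E).
  apply: ge0_le_integral => //.
  - by move=> w _; rewrite lee_fin le_min V0 K0.
  - by apply/measurable_EFinP; exact: measurable_minr.
  - apply: emeasurable_funD; apply/measurable_EFinP; first exact: measurable_funM.
    by apply: measurable_funM => //; exact: measurable_funB.
  - move=> w _; rewrite -EFinD lee_fin.
    have := covered_le1 m w; have := c0 m w.
    have : Num.min (V (t m) w) K <= V (t m) w by rewrite ge_min lexx.
    have : Num.min (V (t m) w) K <= K by rewrite ge_min lexx orbT.
    by move: (Num.min _ _) => x *; nra.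
rewrite ge0_integralD//; first last.
- by apply/measurable_EFinP; apply: measurable_funM => //; exact: measurable_funB.
- by move=> w _; rewrite lee_fin mulr_ge0// subr_ge0.
- by apply/measurable_EFinP; exact: measurable_funM.
- by move=> w _; rewrite lee_fin mulr_ge0.
apply: leeD.
  rewrite -sum_integral_covered// sum_integral_cell.
  apply: (@le_trans _ _ (\int[Pr]_w ((expR (- two_step_gap P * (t m - t j)))%:E *
      (mean_var j w)%:E))%E).
    apply: ge0_le_integral => //.
    - by move=> w _; rewrite lee_fin.
    - exact/measurable_EFinP.
    - by apply: emeasurable_funM => //; exact/measurable_EFinP.
    - by move=> w _; rewrite -EFinM lee_fin mean_var_decay.
  rewrite ge0_integralZl_EFin ?expR_ge0//; last 2 first.
  - by move=> w _; rewrite lee_fin.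
  - exact/measurable_EFinP.
  rewrite lee_wpmul2l ?lee_fin ?expR_ge0//.
  rewrite -sum_integral_cell sum_integral_covered//.
  apply: ge0_le_integral => //.
  - by move=> w _; rewrite lee_fin mulr_ge0.
  - by apply/measurable_EFinP; exact: measurable_funM.
  - exact/measurable_EFinP.
  - by move=> w _; rewrite lee_fin ler_piMr.
under eq_integral do rewrite EFinM.
rewrite ge0_integralZl_EFin//; last 2 first.
- by move=> w _; rewrite lee_fin subr_ge0.
- by apply/measurable_EFinP; exact: measurable_funB.
by rewrite EFinM lee_wpmul2l// lee_fin.
Qed.

End expectation.

(** * Refining the grid *)

Section conclusion.
Context {d : measure_display} {T : measurableType d} {R : realType} {n : nat}.

(** Steps of length [s / m] up to index [m], so that [s] is a point of the grid,
    and of length [(t - s) / m] afterwards: the truncated subtraction switches the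
    second term on. *)
Definition two_piece_grid (s t : R) (m i : nat) : R :=
  (minn i m)%:R * (s / m%:R) + (i - m)%:R * ((t - s) / m%:R).

Lemma two_piece_grid_step (s t : R) m i : 0 <= s -> s <= t ->
  0 <= two_piece_grid s t m i.+1 - two_piece_grid s t m i <= t / m%:R.
Proof.
move=> s0 st; have m0 : 0 <= m%:R^-1 :> R by rewrite invr_ge0.
have sm : 0 <= s / m%:R by rewrite mulr_ge0.
have tsm : 0 <= (t - s) / m%:R by rewrite mulr_ge0// subr_ge0.
have -> : t / m%:R = s / m%:R + (t - s) / m%:R by rewrite -mulrDl; congr (_ / _); lra.
rewrite /two_piece_grid; have [im|] := boolP (i < m)%N.
  have -> : minn i.+1 m = (minn i m).+1 by lia.
  have -> : (i.+1 - m = i - m)%N by lia.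
  by rewrite -natr1; apply/andP; split; nra.
rewrite -leqNgt => mi; have -> : minn i.+1 m = minn i m by lia.
have -> : (i.+1 - m = (i - m).+1)%N by lia.
by rewrite -[(_ - _).+1%:R]natr1; apply/andP; split; nra.
Qed.

Variable Pr : probability T R.

Lemma integral_le_truncated (X : T -> R) (C : \bar R) : measurable_fun setT X ->
  (forall w, 0 <= X w) ->
  (forall k : nat, (\int[Pr]_w (Num.min (X w) k%:R)%:E <= C)%E) ->
  (\int[Pr]_w (X w)%:E <= C)%E.
Proof.
move=> mX X0 XC.
pose g (k : nat) (w : T) : \bar R := (Num.min (X w) k%:R)%:E.
have cvgX w : limn (g^~ w) = (X w)%:E.
  apply/cvg_lim => //; apply: cvg_near_cst; near=> k.
  rewrite /g min_l//; near: k; exact: nbhs_infty_ger.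
have mg k : measurable_fun setT (g k).
  by apply/measurable_EFinP; apply: measurable_minr.
have g0 k w : [set: T] w -> (0 <= g k w)%E.
  by move=> _; rewrite lee_fin le_min X0 ler0n.
have gnd w : [set: T] w -> {homo g^~ w : a b / (a <= b)%N >-> (a <= b)%E}.
  move=> _ a b ab; rewrite lee_fin le_min ge_min lexx/= ge_min.
  by rewrite ler_nat ab orbT.
under eq_integral do rewrite -cvgX.
have h := cvg_monotone_convergence (mu := Pr) measurableT mg g0 gnd.
rewrite -(cvg_lim _ h)//.
apply: lime_le; first by apply/cvg_ex; eexists; exact: h.
by apply: nearW => k; exact: XC.
Unshelve. all: by end_near. Qed.

Lemma variance_decay (P : 'M[R]_n) (pi : 'I_n -> R)
    (N : 'I_n -> R -> {RV Pr >-> nat}) (Y : R -> 'I_n -> {RV Pr >-> R}) (s t : R) :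
  transition_matrix P -> irreducible P -> probability_vector pi ->
  reversible P pi -> smoothing_process P N Y -> 0 <= s -> s <= t ->
  ('E_Pr[variance_functional pi Y t] <=
   'E_Pr[variance_functional pi Y s] * (expR (- two_step_gap P * (t - s)))%:E)%E.
Proof.
move=> tP irr pp rev NY s0 st; rewrite unlock muleC.
apply: integral_le_truncated => [||k].
- exact: measurable_V.
- exact: V_ge0.
apply/lee_addgt0Pr => e e0.
have t_ge0 : 0 <= t by exact: le_trans st.
(* [B / m] bounds the truncation error, as [2 m] steps have length at most
   [t / m]. *)
pose B := k%:R * (2 * (n%:R * t) ^+ 2).
have B0 : 0 <= B by rewrite !mulr_ge0 ?sqr_ge0.
pose m := (Num.truncn (B / e)).+1.
have Bm : B / m%:R <= e.
  rewrite ler_pdivrMr ?ltr0n// mulrC -ler_pdivrMr//.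
  by apply/ltW; rewrite truncnS_gt.
pose g := two_piece_grid s t m.
have m0 : m%:R != 0 :> R by rewrite pnatr_eq0.
have g0 : g 0%N = 0 by rewrite /g /two_piece_grid min0n sub0n !mul0r addr0.
have gs : g m = s.
  by rewrite /g /two_piece_grid minnn subnn mul0r addr0 mulrC divfK.
have gt : g (m + m)%N = t.
  rewrite /g /two_piece_grid (minn_idPr (leq_addr _ _)) addnK -mulrDr -mulrDl.
  by rewrite mulrC divfK// addrC subrK.
have g_step i : 0 <= g i.+1 - g i <= t / m%:R by exact: two_piece_grid_step.
have g_homo : {homo g : i j / (i <= j)%N >-> i <= j}.
  apply: homo_leq => //; first exact: le_trans.
  by move=> i; rewrite -subr_ge0; case/andP: (g_step i).
have := truncated_variance_le tP irr pp rev NY g0 g_homo (leq_addr m m)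
  (ler0n R k).
rewrite gs gt => /le_trans; apply; rewrite leeD2l// lee_fin.
apply: le_trans Bm; rewrite /B -mulrA ler_wpM2l//.
apply: (@le_trans _ _ (\sum_(i < m + m) (n%:R * (t / m%:R)) ^+ 2)).
  apply: ler_sum => i _; have /andP[h0 h1] := g_step i.
  by rewrite ler_sqr ?nnegrE ?mulr_ge0 ?invr_ge0// ler_wpM2l.
rewrite sumr_const card_ord -[leLHS]mulr_natr natrD.
by rewrite le_eqVlt; apply/orP; left; apply/eqP; field.
Qed.

End conclusion.

Theorem theorem2p2 (R : realType) (n : nat) (hn : (2 <= n)%N)
    (P : 'M[R]_n) (pi : 'I_n -> R)
    (P_trans : transition_matrix P) (P_irr : irreducible P)
    (P_aper : aperiodic P) (pi_prob : probability_vector pi)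
    (P_rev : reversible P pi)
    (d : measure_display) (T : measurableType d) (Pr : probability T R)
    (N : 'I_n -> R -> {RV Pr >-> nat}) (Y : R -> 'I_n -> {RV Pr >-> R})
    (Y_smooth : smoothing_process P N Y)
    (Y0_ge0 : {ae Pr, forall w, forall i : 'I_n, 0 <= Y 0 i w}) :
  (forall s t : R, 0 <= s -> s <= t ->
    ('E_Pr[variance_functional pi Y t] <=
     'E_Pr[variance_functional pi Y s] *
       (expR (- two_step_gap P * (t - s)))%:E)%E) /\
  (forall t : R, 0 <= t ->
    ('E_Pr[variance_functional pi Y t] <=
     'E_Pr[variance_functional pi Y 0] *
       (expR (- two_step_gap P * t))%:E)%E).
Proof.
split=> [s t s0 st|t t_ge0]; first exact: variance_decay Y_smooth s0 st.
have := variance_decay P_trans P_irr pi_prob P_rev Y_smooth (lexx 0) t_ge0.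
by rewrite subr0.
Qed.
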